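(* Let $X$ be a Hausdorff space, let $\tau^c$ be the family of all closed subsets of $X$ and $\mathcal S_X=\{\{x\}:x\in X\}$. Let $Y$ be a Hausdorff space with a strictly increasing closed cover $\{B_n\}_{n\in\mathbb N}$. Then $X$ is strongly first countable if and only if there exists a map $\phi:\mathcal S_X\to\mathcal L(X,\mathcal F(Y))$, $\{x\}\mapsto\phi_x$, such that: (i) for each $x\in X$, $\{x\}=\bigcap_{n\in\mathbb N}\phi_x^{-1}[Y\setminus B_n]$; (ii) for all $x,y,z\in X$, $\phi_x(y)\subset\phi_x(z)$ or $\phi_y(z)\subset\phi_x(z)$; (iii) for each $x\in X$ and $F\in\tau^c$ with $x\notin F$, $\phi_x$ is bounded on $F$.
   Context: $\mathbb N$ is the set of positive integers. A sequence $\{B_n\}_{n\in\mathbb N}$ of closed subsets of a space $Y$ is a strictly increasing closed cover of $Y$ if $Y=\bigcup_{n}B_n$, $B_1\neq\emptyset$ and $B_n\subsetneq B_{n+1}$ for each $n$. $\mathcal F(Y)$ is the family of nonempty closed subsets of $Y$. For a set-valued map $\psi:X\to\mathcal F(Y)$ and $B\subset Y$, $\psi^{-1}[B]=\{x\in X:\psi(x)\cap B\neq\emptyset\}$ and $\psi^{\#}[B]=\{x\in X:\psi(x)\subset B\}$. $\psi$ is lower semi-continuous if $\psi^{-1}[V]$ is open in $X$ for each open $V\subset Y$; $\mathcal L(X,\mathcal F(Y))$ is the set of all lower semi-continuous maps $X\to\mathcal F(Y)$. $\psi$ is bounded on $A\subset X$ if $A\subset\psi^{\#}[B_n]$ for some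 $n\in\mathbb N$. A $g$-function for a space $X$ with topology $\tau$ is a map $g:\mathbb N\times X\to\tau$ such that $x\in g(n,x)$ and $g(n+1,x)\subset g(n,x)$ for all $x\in X$, $n\in\mathbb N$. A space $X$ is strongly first countable if there is a $g$-function $g$ for $X$ such that for each $x\in X$, $\{g(n,x):n\in\mathbb N\}$ is a neighborhood base of $x$, and if $y\in g(n,x)$ then $g(n,y)\subset g(n,x)$. *)

(* Defs.v *)
From mathcomp Require Import all_boot.
From mathcomp Require Import boolp classical_sets functions topology.

Set Implicit Arguments.
Unset Strict Implicit.
Unset Printing Implicit Defensive.

Local Open Scope classical_set_scope.

(* Sequences indexed by the positive integers are indexed here by [nat]: index
   [n] stands for the positive integer [n + 1]; in particular [B 0] is the first
   member of a cover and [g 0] the first level of a g-function. *)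

Definition strictly_increasing_closed_cover (Y : topologicalType)
    (B : nat -> set Y) : Prop :=
  [/\ forall n, closed (B n),
      \bigcup_n B n = [set: Y],
      B 0 !=set0 &
      forall n, B n `<` B n.+1].

Definition nonempty_closed_sets (Y : topologicalType) : set (set Y) :=
  [set A | A !=set0 /\ closed A].

Definition lower_preimage (X Y : Type) (psi : X -> set Y) (B : set Y) : set X :=
  [set x | psi x `&` B !=set0].

Definition upper_preimage (X Y : Type) (psi : X -> set Y) (B : set Y) : set X :=
  [set x | psi x `<=` B].

Definition lower_semi_continuous (X Y : topologicalType)
    (psi : X -> set Y) : Prop :=
  forall V : set Y, open V -> open (lower_preimage psi V).

Definition lsc_maps (X Y : topologicalType) : set (X -> set Y) :=
  [set psi | (forall x, nonempty_closed_sets (psi x)) /\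
             lower_semi_continuous psi].
Arguments lsc_maps : clear implicits.

Definition cover_bounded_on (X Y : Type) (B : nat -> set Y)
    (psi : X -> set Y) (A : set X) : Prop :=
  exists n, A `<=` upper_preimage psi (B n).

Definition g_function (X : topologicalType) (g : nat -> X -> set X) : Prop :=
  forall n x, [/\ open (g n x), g n x x & g n.+1 x `<=` g n x].

Definition neighborhood_base (X : topologicalType) (x : X)
    (C : set (set X)) : Prop :=
  (forall U, C U -> nbhs x U) /\
  (forall U, nbhs x U -> exists2 V, C V & V `<=` U).

Definition strongly_first_countable (X : topologicalType) : Prop :=
  exists g : nat -> X -> set X,
    [/\ g_function g,
        forall x, neighborhood_base x [set g n x | n in [set: nat]] &
        forall n x y, g n x y -> g n y `<=` g n x].

(* Main.v *)
Require Import Defs.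
From mathcomp Require Import all_boot.
From mathcomp Require Import boolp classical_sets functions topology.

Local Open Scope classical_set_scope.

(** Points of [X] are compared by how deep they lie in the chains
    [g 0 x, g 1 x, ...], and sets of [Y] by how far they reach into the chain
    [B 0, B 1, ...]; the theorem says that these two scales translate into each
    other.

    From a g-function [g] one lets the value at [y] of the map attached to [x]
    grow along the cover as long as [y] stays in [g 0 x, g 1 x, ...]: it is the
    member of the cover indexed by the first [m] with [y] outside [g m x], and
    all of [Y] if there is no such [m] ([level_map]).  Because the sets [g n x]
    form a neighbourhood base in a Hausdorff space, the latter happens only for
    [y = x], which gives (i); an open set [V] is met by the value at [y] exactly
    when the first member of the cover meeting [V] has been reached, which is a
    condition of the form [g n x y], hence open in [y].  The implication from
    [g n x y] to [g n y `<=` g n x] says that the depth of [z] below [x] is at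
    least the minimum of the depths of [y] below [x] and of [z] below [y], which
    is (ii).  Finally [B n] bounds the values off [g n x], which is (iii).

    Conversely, [g n x] is taken to be the set of the points whose value is not
    contained in [B n] ([escape]).  By (iii) these sets shrink to [x]; by (ii) a
    value [phi_x(z)] contains one of [phi_x(y)] and [phi_y(z)], so it escapes
    from [B n] when both of these do. *)

Lemma cover_subset {Y : topologicalType} {B : nat -> set Y} :
  strictly_increasing_closed_cover B ->
  forall m n, m <= n -> B m `<=` B n.
Proof.
move=> [_ _ _ Blt] m n /subnKC <-.
elim: (n - m) => [|k IH]; first by rewrite addn0.
by rewrite addnS; apply: subset_trans IH _; case: (Blt (m + k)).
Qed.

Lemma cover_nonempty_setD {Y : topologicalType} {B : nat -> set Y} :
  strictly_increasing_closed_cover B ->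
  forall n, ([set: Y] `\` B n) !=set0.
Proof.
by move=> [_ _ _ Blt] n; have [_ /nonsubset[v [_ nBv]]] := Blt n; exists v.
Qed.

Lemma g_function_subset {X : topologicalType} {g : nat -> X -> set X} :
  g_function g -> forall x m n, m <= n -> g n x `<=` g m x.
Proof.
move=> gP x m n /subnKC <-.
elim: (n - m) => [|k IH]; first by rewrite addn0.
by rewrite addnS; apply: subset_trans IH; case: (gP (m + k) x).
Qed.

(** In a Hausdorff space a neighbourhood base determines its point: a point in
    all its members is a cluster point of the neighbourhood filter. *)
Lemma neighborhood_base_separates {X : topologicalType} (x y : X)
    (C : set (set X)) :
  hausdorff_space X -> neighborhood_base x C -> (forall U, C U -> U y) ->
  x = y.
Proof.
move=> hX [_ Cbase] Cy; apply: hX => U V nU nV.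
have [W CW WU] := Cbase U nU.
by exists y; split; [exact: WU (Cy W CW) | exact: nbhs_singleton].
Qed.

(** The point [x] enters through a set [S], meant to be [[set x]], so that no
    choice of a representative is needed.  The condition on [n] involves the
    levels strictly below [n]: it is void at [0], which makes the values
    nonempty. *)
Definition level_map {X Y : Type} (B : nat -> set Y) (g : nat -> X -> set X)
    (S : set X) (y : X) : set Y :=
  [set v | exists x n,
     [/\ S x, B n v & forall k, k < n -> g k x y]].

Section LevelMap.
Context {X Y : topologicalType} {B : nat -> set Y} {g : nat -> X -> set X}.
Context (hB : strictly_increasing_closed_cover B) (gP : g_function g).

Lemma level_map1P (x y : X) (v : Y) :
  level_map B g [set x] y v <->
  exists2 n, B n v & forall k, k < n -> g k x y.
Proof.
by split=> [[_ [n [-> Bnv gxy]]]|[n Bnv gxy]]; [exists n | exists x, n].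
Qed.

Lemma level_map_subset (x y : X) n :
  ~ g n x y -> level_map B g [set x] y `<=` B n.
Proof.
move=> ngy v /level_map1P[m Bmv gy].
apply: (cover_subset hB m n _ v Bmv).
by rewrite leqNgt; apply/negP => /gy.
Qed.

Lemma level_map_full (x y : X) :
  (forall n, g n x y) -> level_map B g [set x] y = [set: Y].
Proof.
move=> gy; apply/seteqP; split=> // v _; apply/level_map1P.
have [_ Bcov _ _] := hB.
by have [n _ Bnv] : (\bigcup_n B n) v by [rewrite Bcov]; exists n.
Qed.

(** Either [y] lies in every [g n x], or the value is the member of the cover
    at the first level that [y] fails to reach; hence
    this union of members of the cover, possibly infinite, is closed. *)
Lemma level_map_nonempty_closed (x y : X) :
  nonempty_closed_sets (level_map B g [set x] y).
Proof.
have [Bcl _ [b B0b] _] := hB.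
split; first by exists b; apply/level_map1P; exists 0.
have [gy|/existsNP ngy] := pselect (forall n, g n x y).
  by rewrite level_map_full//; exact: closedT.
have exn : exists n, `[< ~ g n x y >].
  by have [n ?] := ngy; exists n; exact/asboolP.
have [m /asboolP ngmy mmin] := ex_minnP exn.
suff -> : level_map B g [set x] y = B m by exact: Bcl.
apply/seteqP; split; first exact: level_map_subset.
move=> v Bmv; apply/level_map1P; exists m => // k km.
by apply: contrapT => /asboolP/mmin; rewrite leqNgt km.
Qed.

(** If [n] is the first index such that [B n] meets [V], then the value at [y]
    meets [V] if and only if [y] lies in the last of the open sets [g k x]
    with [k < n]. *)
Lemma level_map_lsc (x : X) :
  lower_semi_continuous (level_map B g [set x]).
Proof.
move=> V _; have [_ Bcov _ _] := hB.
have [->|/set0P[w Vw]] := eqVneq V set0.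
  rewrite (_ : lower_preimage _ _ = set0); first exact: open0.
  by apply/seteqP; split=> // y [? []].
have exn : exists n, `[< B n `&` V !=set0 >].
  have [n _ Bnw] : (\bigcup_n B n) w by rewrite Bcov.
  by exists n; apply/asboolP; exists w.
have [n /asboolP[v [Bnv Vv]] nmin] := ex_minnP exn.
have meetE : lower_preimage (level_map B g [set x]) V =
             [set y | forall k, k < n -> g k x y].
  apply/seteqP; split=> [y [u [/level_map1P[m Bmu gy] Vu]] k kn|y gy].
    apply: gy; apply: leq_trans kn (nmin m _).
    by apply/asboolP; exists u.
  by exists v; split=> //; apply/level_map1P; exists n.
rewrite {}meetE; case: n {Bnv nmin} => [|n].
  rewrite (_ : mkset _ = setT); first exact: openT.
  by apply/seteqP; split.
rewrite (_ : mkset _ = g n x); first by case: (gP n x).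
apply/seteqP; split=> [y gy|y gny k kn]; first exact: gy.
exact: (g_function_subset gP x k n kn).
Qed.

(** An index [n] witnessing that the first inclusion fails is a level reached
    by [y] below [x] and missed by [z] below [x].  By transitivity [z] then
    misses the level [n] below [y], and up to that level, where [g k y] is
    contained in [g k x], it is at least as deep below [x] as below [y]. *)
Lemma level_map_ultra (x y z : X) :
  (forall n a b, g n a b -> g n b `<=` g n a) ->
  level_map B g [set x] y `<=` level_map B g [set x] z \/
  level_map B g [set y] z `<=` level_map B g [set x] z.
Proof.
move=> gtrans; have [|/nonsubset[u [yu nzu]]] := pselect
  (level_map B g [set x] y `<=` level_map B g [set x] z); [by left | right].
have /level_map1P[n Bnu gxy] := yu.
move=> v /level_map1P[m Bmv gyz]; apply/level_map1P; exists m => // k km.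
have [nm|mn] := leqP n m; last first.
  exact: gtrans (gxy k (ltn_trans km mn)) _ (gyz k km).
case: nzu; apply/level_map1P; exists n => // j jn.
exact: gtrans (gxy j jn) _ (gyz j (leq_trans jn nm)).
Qed.

End LevelMap.

Lemma level_map_bigcap {X Y : topologicalType} {B : nat -> set Y}
    {g : nat -> X -> set X} (x : X) :
  strictly_increasing_closed_cover B -> g_function g ->
  (forall y, (forall n, g n x y) -> x = y) ->
  [set x] =
  \bigcap_n lower_preimage (level_map B g [set x]) ([set: Y] `\` B n).
Proof.
move=> hB gP gsep; apply/seteqP; split=> [_ -> n _|y yesc].
  have [v nBv] := cover_nonempty_setD hB n.
  exists v; split=> //; rewrite level_map_full// => k.
  by case: (gP k x).
apply/esym/gsep => n; apply: contrapT => ngy.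
by have [v [/(level_map_subset hB x y n ngy) Bv [_]]] := yesc n I.
Qed.

Definition escape {X Y : Type} (B : nat -> set Y) (phi : set X -> X -> set Y)
    (n : nat) (x : X) : set X :=
  lower_preimage (phi [set x]) ([set: Y] `\` B n).

Lemma escapeP {X Y : Type} (B : nat -> set Y) (phi : set X -> X -> set Y)
    n x y :
  escape B phi n x y <-> ~ phi [set x] y `<=` B n.
Proof.
split=> [[v [pv [_ nBv]]] /(_ v pv)//|/nonsubset[v [pv nBv]]].
by exists v.
Qed.

Lemma escape_g_function {X Y : topologicalType} {B : nat -> set Y}
    {phi : set X -> X -> set Y} :
  strictly_increasing_closed_cover B ->
  (forall x, lower_semi_continuous (phi [set x])) ->
  (forall n x, escape B phi n x x) ->
  g_function (escape B phi).
Proof.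
move=> hB lsc self n x; split=> //.
  apply: lsc; rewrite setTD; apply: closed_openC.
  by case: hB.
move=> y /escapeP esc; apply/escapeP => pB; apply: esc.
exact: subset_trans pB (cover_subset hB n n.+1 (leqnSn n)).
Qed.

(** Boundedness off a neighbourhood [U] of [x] keeps the complement of [U] out
    of some [escape B phi n x]. *)
Lemma escape_neighborhood_base {X Y : topologicalType} (B : nat -> set Y)
    (phi : set X -> X -> set Y) (x : X) :
  g_function (escape B phi) ->
  (forall F, closed F -> ~ F x -> cover_bounded_on B (phi [set x]) F) ->
  neighborhood_base x [set escape B phi n x | n in [set: nat]].
Proof.
move=> gP bnd; split=> [_ [n _ <-]|U].
  by have [op self _] := gP n x; exact: open_nbhs_nbhs.
rewrite nbhsE => -[V [opV Vx] VU].
have [n bndn] := bnd (~` V) (open_closedC opV) (fun nVx => nVx Vx).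
exists (escape B phi n x); first by exists n.
move=> y /escapeP esc; apply: VU; apply: contrapT => nVy.
exact/esc/bndn.
Qed.

Theorem theorem2p6 (X Y : topologicalType) (B : nat -> set Y)
    (hX : hausdorff_space X) (hY : hausdorff_space Y)
    (hB : strictly_increasing_closed_cover B) :
  strongly_first_countable X <->
  exists phi : set X -> (X -> set Y),
    [/\ set_fun (@singletons X) (lsc_maps X Y) phi,
        forall x : X,
          [set x] =
          \bigcap_n lower_preimage (phi [set x]) ([set: Y] `\` B n),
        forall x y z : X,
          phi [set x] y `<=` phi [set x] z \/
          phi [set y] z `<=` phi [set x] z &
        forall (x : X) (F : set X), closed F -> ~ F x ->
          cover_bounded_on B (phi [set x]) F].
Proof.
split=> [[g [gP gbase gtrans]]|[phi [phifun phicap phiultra phibnd]]].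
  exists (level_map B g); split.
  - move=> _ [x _ <-]; split=> [y|].
      exact: level_map_nonempty_closed.
    exact: level_map_lsc.
  - move=> x; apply: level_map_bigcap => // y gy.
    by apply: neighborhood_base_separates (gbase x) _ => // _ [n _ <-].
  - by move=> x y z; apply: level_map_ultra.
  - move=> x F clF nFx.
    have nbF : nbhs x (~` F).
      by apply: open_nbhs_nbhs; split=> //; exact: closed_openC.
    have [_ [n _ <-] gF] := (gbase x).2 _ nbF.
    by exists n => y Fy; apply: level_map_subset => // /gF.
have gP : g_function (escape B phi).
  apply: escape_g_function => // [x|n x].
    by have [] : lsc_maps X Y (phi [set x]) by apply: phifun; exists x.
  have : [set x] x by [].
  by rewrite [X in X x]phicap; apply.
exists (escape B phi); split=> // [x|n x y /escapeP escy z /escapeP escz].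
  by apply: escape_neighborhood_base => // F; apply: phibnd.
apply/escapeP => pB; have [yz|yz] := phiultra x y z.
  exact/escy/(subset_trans yz).
exact/escz/(subset_trans yz).
Qed.
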